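(* Let $G$ be a graph, let $f:G\to G$ be a vertex map with linearization $L_f:G\to G$, and let $M(L_f)$ be its Markov matrix. If $M(L_f)$ is irreducible and is not a permutation matrix, then $L_f$ is topologically transitive.
   Context: Graph: a connected space $G$ that is a union of finitely many vertices and finitely many edges $E_1,\dots,E_e$. Each edge is homeomorphic to $[0,1]$, its two boundary points are distinct vertices (no loops), no vertex is an interior point of an edge, and two distinct edges intersect in the empty set, one vertex or two vertices (so several edges may join the same two vertices). Each edge is given unit length via a fixed homeomorphism with $[0,1]$; a path of $m$ edges has length $m$. Vertex map: a continuous map $f:G\to G$ that permutes the vertices of $G$. Linearization: $L_f:G\to G$ agrees with $f$ on vertices, and for each edge $E_i$ with endpoints $V_1,V_2$, $L_f$ maps $E_i$ linearly (i.e. at constant speed with respect to edge length) onto the unique reduced (no backtracking) edge path from $f(V_1)$ to $f(V_2)$ that is homotopic to $f|_{E_i}$ relative to the endpoints of $E_i$. Markov matrix: $M=M(L_f)$ is the $e\times e$ matrix whose entry $M_{i,j}$ is the number of closed subintervals of $E_j$ that $L_f$ maps homeomorphically onto $E_i$ (equivalently, the number of times the edge path $L_f(E_j)$ traverses $E_i$). A non-negative square matrix $M$ is irreducible if for each $i,j$ there is a positive integer $k$ with $(M^k)_{i,j}>0$. A continuous map $g:X\to X$ of a compact space is topologically transitive if for every pair of non-empty open sets $U,V\subseteq X$ there is a positive integer $k$ such that $g^k(U)\cap V\neq\emptyset$. *)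

(* Defs.v *)
(* MathComp / MathComp-Analysis *)
From mathcomp Require Import all_boot all_order all_algebra finmap.
From mathcomp Require Import all_classical all_reals all_analysis.
Set Implicit Arguments.
Unset Strict Implicit.
Unset Printing Implicit Defensive.
Import Order.TTheory GRing.Theory Num.Theory.
Import numFieldNormedType.Exports.
Local Open Scope classical_set_scope.
Local Open Scope ring_scope.

Definition maps_homeomorphically (X Y : topologicalType) (g : X -> Y)
    (A : set X) (B : set Y) : Prop :=
  exists h : Y -> X,
    [/\ {within A, continuous g}, {within B, continuous h},
        (forall x, A x -> B (g x) /\ h (g x) = x)
      & (forall y, B y -> A (h y) /\ g (h y) = y)].

(* The edge of index [i] is the image of [0, 1] under [chart i], the fixed
   homeomorphism that gives it unit length and whose restriction to {0, 1}
   lists its boundary points; only the values of [chart i] on [0, 1] matter.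
   The boundary points are distinct because [chart i] is injective there.
   The Hausdorff axiom, implicit in the word "space", makes the edges closed,
   so that the topology is the one glued from the edges. *)
Record graph (R : realType) := Graph {
  space :> topologicalType;
  vertices : set space;
  edge_num : nat;
  chart : 'I_edge_num -> R -> space;
  edge := fun i => chart i @` `[0, 1];
  graph_hausdorff : hausdorff_space space;
  graph_connected : connected [set: space];
  vertices_finite : finite_set vertices;
  graph_cover : [set: space] = vertices `|` \bigcup_i edge i;
  chart_homeo : forall i, maps_homeomorphically (chart i) `[0, 1] (edge i);
  chart_boundary : forall i, vertices (chart i 0) /\ vertices (chart i 1);
  chart_interior : forall i t, 0 < t < 1 -> ~ vertices (chart i t);
  edge_inter : forall i j, i != j ->
    [\/ edge i `&` edge j = set0,
        exists2 v, vertices v & edge i `&` edge j = [set v]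
      | exists v w, [/\ vertices v, vertices w, v <> w
                      & edge i `&` edge j = [set v; w]]] }.

Section Linearization.
Variables (R : realType) (G : graph R).

Definition vertex_map (f : G -> G) : Prop :=
  continuous f /\ set_bij (@vertices R G) (@vertices R G) f.

(* An edge with a direction: the boolean is [true] when the edge is traversed
   from [chart i 1] to [chart i 0]. *)
Definition dir_edge : Type := ('I_(edge_num G) * bool)%type.

Definition dir_chart (a : dir_edge) (t : R) : G :=
  chart a.1 (if a.2 then 1 - t else t).

Fixpoint is_edge_path (v : G) (p : seq dir_edge) (w : G) : Prop :=
  if p is a :: q then dir_chart a 0 = v /\ is_edge_path (dir_chart a 1) q w
  else v = w.

Definition backtrack (a b : dir_edge) : bool := (a.1 == b.1) && (a.2 != b.2).

Definition reduced (p : seq dir_edge) : bool :=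
  sorted (fun a b => ~~ backtrack a b) p.

(* [g], restricted to [0, 1], runs at constant speed along the edge path [p]
   issued from [v]: the k-th of the [size p] subintervals of equal length is
   mapped linearly onto the k-th edge of [p]. *)
Definition constant_speed (g : R -> G) (v : G) (p : seq dir_edge) : Prop :=
  (p = [::] -> forall t, 0 <= t <= 1 -> g t = v) /\
  (forall k a, onth p k = Some a -> forall s, 0 <= s <= 1 ->
     g ((k%:R + s) / (size p)%:R) = dir_chart a s).

Definition homotopic_rel_ends (X : topologicalType) (g h : R -> X) : Prop :=
  exists H : R * R -> X,
    [/\ {within `[0, 1] `*` `[0, 1], continuous H},
        (forall t, 0 <= t <= 1 -> H (0, t) = g t),
        (forall t, 0 <= t <= 1 -> H (1, t) = h t)
      & (forall s, 0 <= s <= 1 -> H (s, 0) = g 0 /\ H (s, 1) = g 1)].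

(* The reduced edge path [p] in a given homotopy class is unique, so [f]
   determines [L]. *)
Definition is_linearization (f L : G -> G) : Prop :=
  (forall v, vertices v -> L v = f v) /\
  (forall i : 'I_(edge_num G), exists p : seq dir_edge,
     [/\ is_edge_path (f (chart i 0)) p (f (chart i 1)),
         reduced p,
         constant_speed (L \o chart i) (f (chart i 0)) p
       & homotopic_rel_ends (f \o chart i) (L \o chart i)]).

(* The closed subinterval [chart j @` `[a, b]] of the edge [j] is represented
   by the pair [(a, b)]. *)
Definition covering_intervals (L : G -> G) (i j : 'I_(edge_num G)) :
    set (R * R) :=
  [set ab | [/\ 0 <= ab.1, ab.1 <= ab.2, ab.2 <= 1
     & maps_homeomorphically L (chart j @` `[ab.1, ab.2]) (edge i)]].

(* [fset_set] sends a finite set to the corresponding [fset], and an infinite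
   set to the empty one; for a linearization the sets at hand are finite. *)
Definition markov_matrix (L : G -> G) : 'M[nat]_(edge_num G) :=
  \matrix_(i, j) #|` fset_set (covering_intervals L i j) |.

End Linearization.

(* Non-negativity is built in the coefficient semiring [nat]. *)
Definition irreducible_mx (n : nat) (M : 'M[nat]_n) : Prop :=
  forall i j, exists2 k : nat, (0 < k)%N & (0 < (M ^+ k) i j)%N.

Definition topologically_transitive (X : topologicalType) (g : X -> X) : Prop :=
  [/\ compact [set: X], continuous g
    & forall U V : set X, open U -> open V -> U !=set0 -> V !=set0 ->
        exists2 k : nat, (0 < k)%N & (iter k g @` U) `&` V !=set0].

(* Main.v *)
(* Some edge is stretched, since otherwise L permutes the edges and M is a
   permutation matrix.  Let U be open and non-empty.  As long as the iterates
   of an arc in U contain no vertex in their interior they are arcs inside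
   edges, and irreducibility makes their lengths double infinitely often, which
   is absurd; so some iterate of U contains a germ, i.e. an arc issued from a
   vertex.  The image of a germ is again a germ unless it covers an edge, so the
   same length argument gives an iterate of U that covers an edge.
   Irreducibility then carries this edge onto any prescribed edge. *)
Require Import Defs.
From mathcomp Require Import all_boot all_order all_algebra finmap.
From mathcomp Require Import all_classical all_reals all_analysis.
From mathcomp Require Import perm lra.
Set Implicit Arguments.
Unset Strict Implicit.
Unset Printing Implicit Defensive.
Import Order.TTheory GRing.Theory Num.Theory.
Import numFieldNormedType.Exports.
Local Open Scope classical_set_scope.
Local Open Scope ring_scope.

(** * Continuity on subsets *)

Lemma within_continuous_comp (X Y Z : topologicalType) (f : X -> Y)
    (g : Y -> Z) (A : set X) (B : set Y) :
  {within A, continuous f} -> {within B, continuous g} ->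
  (forall x, A x -> B (f x)) -> {within A, continuous (g \o f)}.
Proof.
move=> /subspace_continuousP cf /subspace_continuousP cg AB.
apply/subspace_continuousP => x Ax P /(cg _ (AB _ Ax)) gP.
have {gP} := cf _ Ax _ gP; rewrite /nbhs /= /within /=.
by apply: filterS => y H Ay; exact: H Ay (AB _ Ay).
Qed.

Lemma eq_within_continuous (X Y : topologicalType) (f g : X -> Y)
    (A : set X) :
  (forall x, A x -> f x = g x) ->
  {within A, continuous f} -> {within A, continuous g}.
Proof.
by move=> fg; apply: subspace_eq_continuous => x /set_mem; exact: fg.
Qed.

Lemma continuous_bigsetU (X Y : topologicalType) (I : eqType) (f : X -> Y)
    (A : I -> set X) (s : seq I) :
  (forall i, closed (A i)) -> (forall i, {within A i, continuous f}) ->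
  {within \big[setU/set0]_(i <- s) A i, continuous f}.
Proof.
move=> clA cf; elim: s => [|i s IH].
  by rewrite big_nil; exact: continuous_subspace0.
rewrite big_cons; apply: withinU_continuous => //.
by apply: closed_bigsetU => j _.
Qed.

(** * Irreducible matrices and growth of lengths *)

Lemma irreducible_invariant (n : nat) (M : 'M[nat]_n) (T : set 'I_n) :
  irreducible_mx M -> T !=set0 ->
  (forall i j, T j -> (0 < M i j)%N -> T i) -> forall i, T i.
Proof.
move=> Mirr [j Tj] Tinv i; have [k _ +] := Mirr i j.
elim: k i => [|k IH] i.
  by rewrite expr0 mxE; case: eqVneq => [->|].
rewrite exprS mxE lt0n sum_nat_seq_neq0.
case/hasP => l _ /=; rewrite muln_eq0 negb_or -!lt0n => /andP[Mil Mlj].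
exact: Tinv (IH _ Mlj) Mil.
Qed.

Lemma irreducible_row_neq0 (n : nat) (M : 'M[nat]_n) i :
  irreducible_mx M -> exists j, (0 < M i j)%N.
Proof.
move=> Mirr; have [[//|k] _] := Mirr i i.
rewrite exprS mxE lt0n sum_nat_seq_neq0.
case/hasP => l _ /=; rewrite muln_eq0 negb_or -!lt0n => /andP[Mil _].
by exists l.
Qed.

(* For a state [(j, l)], [n j] is the number of edges crossed by the image of
   the edge [j] and [l] the length of an arc in it.  The set of states of the
   form [(j, l)], for a fixed [l], cannot be invariant, as irreducibility would
   force [n j = 1] for all [j]; hence lengths double infinitely often. *)
Lemma unbounded_length (R : realType) (e : nat) (M : 'M[nat]_e)
    (n : 'I_e -> nat) (suc : 'I_e -> set 'I_e) (S : 'I_e -> R -> Prop) :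
  irreducible_mx M -> (forall j, (0 < n j)%N) ->
  (exists j, (1 < n j)%N) ->
  (forall i j, (0 < M i j)%N -> suc j i) ->
  (forall j i i', n j = 1%N -> suc j i -> suc j i' -> i = i') ->
  (forall j l, S j l -> l <= 1) ->
  (forall j l, S j l -> exists2 i, suc j i & S i ((n j)%:R * l)) ->
  forall j l, 0 < l -> ~ S j l.
Proof.
move=> Mirr n_gt0 [j0 nj0] Msuc suc1 S_le1 S_step.
have dbl l : 0 < l -> (exists j, S j l) ->
    exists l', 2 * l <= l' /\ exists j, S j l'.
  move=> l0 [j Sjl]; apply: contrapT => no_dbl.
  (* Without doubling, every state of length [l] sits on an edge with [n i = 1], and its unique
     successor again carries length [l]; irreducibility spreads this to [j0]. *)
  have n1 i : S i l -> n i = 1%N.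
    move=> Sil; apply/eqP; rewrite eqn_leq n_gt0 andbT leqNgt; apply/negP => ni.
    have [i' _ Si'] := S_step _ _ Sil; apply: no_dbl.
    exists ((n i)%:R * l); split; last by exists i'.
    by apply: ler_wpM2r; [exact: ltW|rewrite ler_nat].
  have /n1 : S j0 l; last by move=> E; rewrite E in nj0.
  apply: (irreducible_invariant (T := fun i => S i l)) Mirr _ _ _.
    by exists j.
  move=> i i' Si' /Msuc sii'; have ni' := n1 _ Si'.
  have [i'' si'' Si''] := S_step _ _ Si'.
  by rewrite (suc1 _ _ _ ni' sii' si''); move: Si''; rewrite ni' mul1r.
have dblk k l : 0 < l -> (exists j, S j l) ->
    exists l', 2 ^+ k * l <= l' /\ exists j, S j l'.
  move=> l0 jl; elim: k => [|k [l' [ll' jl']]].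
    by exists l; rewrite expr0 mul1r.
  have l'0 : 0 < l' by apply: lt_le_trans ll'; rewrite mulr_gt0 ?exprn_gt0.
  have [l'' [ll'' jl'']] := dbl _ l'0 jl'; exists l''; split=> //.
  by apply: le_trans ll''; rewrite exprS -mulrA ler_pM2l.
(* The exponent [k] exceeds [l^-1], so [2 ^+ k * l] exceeds 1. *)
move=> j l l0 Sjl; have := archi_boundP (ltW (_ : 0 < l^-1)).
rewrite invr_gt0 => /(_ l0); set k := Num.bound _ => kl.
have [l' [ll' [i /S_le1 l'1]]] := dblk k l l0 (ex_intro _ j Sjl).
have : 1 < 2 ^+ k * l.
  rewrite -ltr_pdivrMr// div1r (lt_le_trans kl)// -natrX ler_nat.
  by apply: ltnW; exact: ltn_expl.
by move/lt_le_trans => /(_ _ ll') /lt_le_trans /(_ l'1); rewrite ltxx.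
Qed.

(** * Topology of the graph *)

Section GraphTopology.
Variables (R : realType) (G : graph R).
Implicit Types (i j : 'I_(edge_num G)) (a : dir_edge G).

Lemma chart_inj i s t : 0 <= s <= 1 -> 0 <= t <= 1 ->
  chart i s = chart i t -> s = t.
Proof.
move=> s01 t01 st; have [h [_ _ hK _]] := chart_homeo i.
have hE u : 0 <= u <= 1 -> h (chart i u) = u.
  by move=> u01; have [] : edge i (chart i u) /\ h (chart i u) = u
    by apply: hK; rewrite /= in_itv.
by rewrite -(hE s)// st hE.
Qed.

Lemma edge_compact i : compact (edge i).
Proof.
have [h [ch _ _ _]] := chart_homeo i.
exact: continuous_compact ch (@segment_compact _ _ _).
Qed.

Lemma edge_closed i : closed (edge i).
Proof.
by apply: compact_closed; [exact: graph_hausdorff|exact: edge_compact].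
Qed.

Lemma chart_edge i t : 0 <= t <= 1 -> edge i (chart i t).
Proof. by move=> t01; exists t => //=; rewrite in_itv. Qed.

Lemma half_itv01 : 0 <= (2^-1 : R) <= 1.
Proof. by lra. Qed.

Lemma rev_itv01 (b : bool) (t : R) :
  0 <= t <= 1 -> 0 <= (if b then 1 - t else t) <= 1.
Proof. by case: b => //; lra. Qed.

Lemma dir_chart_edge a t : 0 <= t <= 1 -> edge a.1 (dir_chart a t).
Proof. by move=> t01; apply: chart_edge; apply: rev_itv01. Qed.

Lemma dir_chart_inj a s t : 0 <= s <= 1 -> 0 <= t <= 1 ->
  dir_chart a s = dir_chart a t -> s = t.
Proof.
move=> s01 t01 /(chart_inj (rev_itv01 _ s01) (rev_itv01 _ t01)).
by case: a.2 => //; lra.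
Qed.

Lemma dir_chartN i b t : dir_chart (i, ~~ b) t = dir_chart (i, b) (1 - t) :> G.
Proof. by rewrite /dir_chart /=; case: b => //=; rewrite subKr. Qed.

Lemma edge_dir_chart a x : edge a.1 x ->
  exists2 t, 0 <= t <= 1 & x = dir_chart a t.
Proof.
move=> [t]; rewrite /= in_itv /= => t01 <-.
exists (if a.2 then 1 - t else t); first exact: rev_itv01.
by rewrite /dir_chart; case: a.2 => //; rewrite subKr.
Qed.

(** Distinct edges meet only in vertices and a midpoint is not a vertex, so a midpoint identifies
    its edge. *)
Lemma edge_half i j : edge j (chart i 2^-1) -> i = j.
Proof.
move=> hj; apply/eqP; apply/negP => /negP ij.
have /(chart_interior (i := i)) : 0 < (2^-1 : R) < 1 by lra.
have : (edge i `&` edge j) (chart i 2^-1).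
  by split=> //; apply: chart_edge; exact: half_itv01.
case: (edge_inter ij) => [->//|[v vv ->] ->//|[v [w [vv vw _ ->]]]].
by case=> ->.
Qed.

(** A vertex [v] on no edge would be isolated: the edges and the other vertices form a closed set
    [C] with complement [[set v]]. This contradicts connectedness. *)
Lemma edge_cover : (0 < edge_num G)%N -> [set: G] = \bigcup_i edge i.
Proof.
move=> e0; apply/seteqP; split=> // v _; apply: contrapT => nv.
pose C := (\bigcup_i edge i) `|` (@vertices R G `\ v).
have clC : closed C.
  apply: closedU.
    by apply: closed_bigcup => [|i _]; [exact: finite_finset|exact: edge_closed].
  have /hausdorff_accessible/accessible_finite_set_closed := @graph_hausdorff R G.
  by apply; apply: finite_setD; exact: vertices_finite.
have CE : ~` C = [set v].
  apply/seteqP; split=> x /=; last by move=> -> [//|[_ /=]]; exact.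
  move=> nCx; have := graph_cover G => /seteqP [/(_ x I) + _].
  case=> [vx|ex]; last by case: nCx; left.
  by apply: contrapT => xv; apply: nCx; right.
have /seteqP[_ /(_ (chart (Ordinal e0) 0) I)] : [set v] = setT.
  apply: (@graph_connected R G); first by exists v.
    by exists (~` C); [exact: closed_openC|rewrite CE setTI].
  exists [set v]; last by rewrite setTI.
  have /hausdorff_accessible/accessible_closed_set1 := @graph_hausdorff R G.
  exact.
move=> /= vE; apply: nv; rewrite -vE; exists (Ordinal e0) => //.
by apply: chart_edge; rewrite lexx ler01.
Qed.

Lemma graph_compact : (0 < edge_num G)%N -> compact [set: G].
Proof.
move=> e0; rewrite edge_cover// -bigsetU_fset_set//; last exact: finite_finset.
by apply: bigsetU_compact => i _; exact: edge_compact.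
Qed.

(** The edges are finitely many closed sets covering the graph, and on each of them [f] factors
    through the inverse of the chart. *)
Lemma graph_continuous (f : G -> G) : (0 < edge_num G)%N ->
  (forall i, {within `[0, 1], continuous (f \o chart i)}) -> continuous f.
Proof.
move=> e0 cf; apply/continuous_subspace_setT.
rewrite edge_cover// -bigsetU_fset_set; last exact: finite_finset.
apply: continuous_bigsetU => i; first exact: edge_closed.
have [h [_ ch _ hK]] := chart_homeo i.
apply: (@eq_within_continuous _ _ ((f \o chart i) \o h)).
  by move=> x /hK [_ /= ->].
by apply: within_continuous_comp ch (cf i) _ => x /hK[].
Qed.

Lemma open_arc (U : set G) : (0 < edge_num G)%N -> open U -> U !=set0 ->
  exists j b c, [/\ 0 <= b, b < c, c <= 1 & chart j @` `[b, c] `<=` U].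
Proof.
move=> e0 oU [x Ux]; have := edge_cover e0 => /seteqP[/(_ x I) + _].
case=> j _ [t t01 tx]; have [h [/subspace_continuousP ch _ _ _]] := chart_homeo j.
have nU : nbhs (chart j t) U by rewrite tx; exact: open_nbhs_nbhs.
have := ch t t01 U nU; rewrite /nbhs /= /within /= => /nbhs_ballP [r /= r0 rU].
move: t01; rewrite /= in_itv /= => t01.
(* The bound [r / 2] keeps the arc in the ball; the bound [1 / 2] leaves room in the unit interval
   on at least one side of [t]. *)
pose d := Num.min (r / 2) (1 / 2).
have dr : d <= r / 2 by rewrite ge_min lexx.
have d1 : d <= 1 / 2 by rewrite ge_min lexx orbT.
have d0 : 0 < d by rewrite lt_min; apply/andP; split; lra.
have arcU b c : 0 <= b -> c <= 1 -> t - d <= b -> c <= t + d ->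
    chart j @` `[b, c] `<=` U.
  move=> b0 c1 tb ct y [s /=]; rewrite in_itv /= => sbc <-; apply: rU.
    by rewrite /ball /= ltr_norml; apply/andP; split; lra.
  by rewrite in_itv /=; lra.
have [th|th] := lerP t (1 / 2).
  by exists j, t, (t + d); split; [lra|lra|lra|apply: arcU; lra].
by exists j, (t - d), t; split; [lra|lra|lra|apply: arcU; lra].
Qed.

End GraphTopology.

(** * Edge paths and the Markov matrix *)

Section Linearization.
Variables (R : realType) (G : graph R) (L : G -> G).
Implicit Types (i j : 'I_(edge_num G)) (a : dir_edge G) (p : seq (dir_edge G)).

Definition traverses j p : Prop :=
  (0 < size p)%N /\
  forall k a s, onth p k = Some a -> 0 <= s <= 1 ->
    L (chart j ((k%:R + s) / (size p)%:R)) = dir_chart a s.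

Definition successor p : set 'I_(edge_num G) := [set i | i \in map fst p].

Lemma onth_successor p k a : onth p k = Some a -> successor p a.1.
Proof. by move=> pk; apply: map_f; apply/onthP; exists k. Qed.

Lemma edge_position p (t : R) : (0 < size p)%N -> 0 <= t < 1 ->
  exists k a s, [/\ onth p k = Some a, 0 <= s < 1
                 & t = (k%:R + s) / (size p)%:R].
Proof.
move=> p0 /andP[t0 t1]; have n0 : 0 < (size p)%:R :> R by rewrite ltr0n.
(* Integer and fractional parts of [t * size p] give [k] and [s]; excluding [t = 1] ensures
   [k < size p]. *)
pose k := Num.truncn (t * (size p)%:R).
have /andP[kt tk] : k%:R <= t * (size p)%:R < k.+1%:R.
  by apply: truncn_itv; rewrite mulr_ge0// ltW.
have kn : (k < size p)%N.
  rewrite -(ltr_nat R); apply: le_lt_trans kt _.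
  by rewrite -[ltRHS]mul1r ltr_pM2r.
have : onth p k by rewrite onthTE.
case E : (onth p k) => [a|//] _.
exists k, a, (t * (size p)%:R - k%:R); split=> //.
  by move: tk; rewrite -natr1; lra.
by rewrite addrC subrK mulfK// gt_eqF.
Qed.

Lemma traverses_edge j p x : traverses j p -> edge j x ->
  exists2 i, successor p i & edge i (L x).
Proof.
move=> [p0 Lp] [t /= + <-]; rewrite in_itv /= => /andP[t0].
rewrite le_eqVlt => /predU1P[->|t1]; last first.
  have [|k [a [s [pk /andP[s0 s1] ->]]]] := edge_position p0 (t := t).
    by rewrite t0.
  exists a.1; first exact: onth_successor pk.
  have s01 : 0 <= s <= 1 by lra.
  by rewrite (Lp _ _ _ pk s01); exact: dir_chart_edge.
(* The remaining point [t = 1] is the end of the last subinterval. *)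
have : onth p (size p).-1 by rewrite onthTE ltn_predL.
case E : (onth p _) => [a|//] _.
exists a.1; first exact: onth_successor E.
have := Lp _ _ 1 E; rewrite natr1 prednK// divff ?pnatr_eq0 -?lt0n//.
by move=> ->; [apply: dir_chart_edge|]; rewrite ler01 lexx.
Qed.

Lemma markov_cover i j :
  (0 < markov_matrix L i j)%N -> edge i `<=` L @` edge j.
Proof.
rewrite mxE cardfs_gt0 => ne y iy.
have [[b c]] : covering_intervals L i j !=set0.
  by apply/set0P; apply: contraNneq ne => ->; rewrite fset_set0.
case=> /= b0 _ c1 [h [_ _ _ /(_ _ iy)[[t + tE] hy]]].
rewrite /= in_itv /= => tbc; exists (h y) => //.
by rewrite -tE; apply: chart_edge; lra.
Qed.

(** The midpoint of edge [i] is the image of a point of edge [j], hence lies on an edge of the path;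
    that edge can only be [i]. *)
Lemma markov_successor i j p :
  traverses j p -> (0 < markov_matrix L i j)%N -> successor p i.
Proof.
move=> tp /markov_cover /(_ (chart i 2^-1)).
case; first by apply: chart_edge; exact: half_itv01.
move=> x /(traverses_edge tp)[i' pi' xi'] xE.
by move: xi'; rewrite xE => /edge_half ->.
Qed.

Lemma image_iterS k (A U : set G) :
  A `<=` iter k L @` U -> L @` A `<=` iter k.+1 L @` U.
Proof. by move=> AU _ [x /AU[u Uu <-] <-]; exists u. Qed.

Lemma edge_iter_cover i j k : (0 < (markov_matrix L ^+ k) i j)%N ->
  edge i `<=` iter k L @` edge j.
Proof.
elim: k i => [|k IH] i.
  by rewrite expr0 mxE; case: eqVneq => [->|//] _ x xj; exists x.
rewrite exprS mxE lt0n sum_nat_seq_neq0.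
case/hasP => l _ /=; rewrite muln_eq0 negb_or -!lt0n => /andP[Mil Mlj].
apply: subset_trans (markov_cover Mil) _.
by apply: image_iterS; exact: IH.
Qed.

(* When all edge paths have one edge, [L] maps edges homeomorphically onto
   edges, and surjectivity on edges comes from irreducibility. *)
Lemma markov_is_perm (P : 'I_(edge_num G) -> seq (dir_edge G)) :
  continuous L -> (forall j, traverses j (P j)) ->
  irreducible_mx (markov_matrix L) -> (forall j, size (P j) <= 1)%N ->
  is_perm_mx (markov_matrix L).
Proof.
move=> cL PP Mirr P1.
have /choice[A PA] : forall j, exists a, P j = [:: a].
  move=> j; have [+ _] := PP j; have := P1 j.
  by case: (P j) => [|a []]//; exists a.
have LA j s : 0 <= s <= 1 -> L (chart j s) = dir_chart (A j) s.
  move=> s01; have [_ /(_ 0%N (A j) s)] := PP j.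
  by rewrite PA /= divr1 add0r; exact.
have sucA i j : successor (P j) i -> i = (A j).1.
  by rewrite /successor PA /= inE => /eqP.
have MA i j : markov_matrix L i j = (i == (A j).1) :> nat.
  case: eqVneq => [->{i}|ij]; last first.
    apply/eqP; rewrite -leqn0 leqNgt; apply/negP => /(markov_successor (PP j)).
    by move/sucA => /eqP; rewrite (negPf ij).
  (* As [L] is injective on edge [j], an interval whose image is a whole edge contains every
     parameter. *)
  rewrite mxE (_ : covering_intervals L _ j = [set (0, 1)]).
    by rewrite fset_set1 cardfs1.
  apply/seteqP; split=> [[b c] [/= b0 bc c1 [h [_ _ _ onto]]]|_ ->].
    have hit u : 0 <= u <= 1 -> b <= u <= c.
      move=> u01; have [[t + tE] ] := onto _ (dir_chart_edge (A j) u01).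
      rewrite /= in_itv /= -tE => tbc.
      have t01 : 0 <= t <= 1 by lra.
      by rewrite LA// => /dir_chart_inj => /(_ t01 u01) <-.
    have /andP[b_le0 _] : b <= 0 <= c by apply: hit; rewrite lexx ler01.
    have /andP[_ c_ge1] : b <= 1 <= c by apply: hit; rewrite lexx ler01.
    by congr (_, _); lra.
  split=> //=; have [h [_ ch hK Kh]] := chart_homeo (A j).1.
  (* The change of parameter between [chart] and [dir_chart], an involution. *)
  pose r (t : R) := if (A j).2 then 1 - t else t.
  have r01 t : `[0, 1]%classic t -> `[0, 1]%classic (r t).
    by rewrite /= !in_itv /=; exact: rev_itv01.
  have rK t : r (r t) = t by rewrite /r; case: (A j).2 => //; rewrite subKr.
  exists (chart j \o (r \o h)); split.
  - exact: continuous_subspaceT.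
  - have [_ [cj _ _ _]] := chart_homeo j.
    apply: (within_continuous_comp _ cj); last by move=> x /Kh[hx _]; exact: r01.
    have rc : {within `[0, 1], continuous r}.
      apply: continuous_subspaceT => t; rewrite /r; case: (A j).2; last exact.
      by apply: cvgB; [exact: cvg_cst|exact: cvg_id].
    by apply: within_continuous_comp ch rc _ => x /Kh[].
  - move=> _ [t t01 <-]; have := t01; rewrite /= in_itv /= => t01'.
    rewrite LA//; split; first exact: dir_chart_edge.
    by have [_ ->] := hK _ (r01 _ t01); rewrite rK.
  - move=> y /Kh[hy yE]; split; first by exists (r (h y)) => //; exact: r01.
    have := r01 _ hy; rewrite /= in_itv /= => rhy.
    by rewrite /= LA// /dir_chart -/(r _) rK.
have surj i : exists j, i = (A j).1.
  have [j] := irreducible_row_neq0 i Mirr.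
  by rewrite MA; case: eqVneq => // -> _; exists j.
(* A right inverse of the edge map is injective, hence a permutation of a finite set. *)
have /choice[g gK] := surj.
have g_inj : injective g by move=> i i' gg; rewrite (gK i) (gK i') gg.
apply/existsP; exists (perm g_inj); apply/eqP/matrixP => i j.
rewrite MA !mxE permE (_ : (i == _) = (g i == j)); first by case: eqP.
apply/eqP/eqP => [iA|<-//].
by have := gK (finv g j); rewrite (f_finv g_inj) -iA => <-; rewrite f_finv.
Qed.

End Linearization.

(** * Growth of germs and arcs under iteration *)

Section Expansion.
Variables (R : realType) (G : graph R) (L : G -> G).
Variable P : 'I_(edge_num G) -> seq (dir_edge G).
Implicit Types (i j : 'I_(edge_num G)) (a : dir_edge G) (U : set G).

(** The iterate and the end of the edge are quantified away, so that only the edge and the length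
    remain, as in the states of [unbounded_length]. *)
Definition germ_in U j (l : R) : Prop :=
  exists k b, [/\ 0 < l, l <= 1
    & dir_chart (j, b) @` `[0, l] `<=` iter k L @` U].

Definition arc_in U j (l : R) : Prop :=
  exists k b c, [/\ 0 <= b, b < c, c <= 1, c - b = l
    & chart j @` `[b, c] `<=` iter k L @` U].

(** A germ at the start of edge [j] follows the first edge of the path; one at the other end follows
    the last edge, reversed. *)
Lemma germ_image j (b : bool) p : traverses L j p ->
  exists2 a, successor p a.1 & forall s, 0 <= s <= 1 ->
    L (dir_chart (j, b) (s / (size p)%:R)) = dir_chart a s.
Proof.
move=> [p0 Lp]; have n0 : (size p)%:R != 0 :> R by rewrite pnatr_eq0 -lt0n.
case: b.
  have : onth p (size p).-1 by rewrite onthTE ltn_predL.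
  case E : (onth p _) => [[i d]|//] _; exists (i, ~~ d).
    exact: onth_successor E.
  move=> s s01; rewrite dir_chartN.
  rewrite -(Lp _ _ (1 - s) E) ?(rev_itv01 true s01)//; congr (L _).
  by rewrite /dir_chart /= addrA natr1 prednK// mulrBl divff.
have : onth p 0 by rewrite onthTE.
case E : (onth p 0) => [a|//] _; exists a; first exact: onth_successor E.
by move=> s s01; rewrite -(Lp _ _ s E)// add0r.
Qed.

(* If the image of a germ crosses another vertex, it covers an edge; otherwise
   it is again a germ, as its initial vertex is sent to a vertex. *)
Lemma germ_step U j l : traverses L j (P j) ->
  (forall k i, ~ edge i `<=` iter k L @` U) -> germ_in U j l ->
  exists2 i, successor (P j) i & germ_in U i ((size (P j))%:R * l).
Proof.
move=> tP noU [k [b [l0 l1 lU]]]; have [p0 _] := tP.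
have n0 : 0 < (size (P j))%:R :> R by rewrite ltr0n.
have [a sa La] := germ_image b tP; exists a.1 => //.
have aU s : 0 <= s <= 1 -> s <= (size (P j))%:R * l ->
    (iter k.+1 L @` U) (dir_chart a s).
  move=> s01 sl; rewrite -(La _ s01); apply: (image_iterS lU).
  exists (dir_chart (j, b) (s / (size (P j))%:R)) => //.
  exists (s / (size (P j))%:R) => //; rewrite /= in_itv /=.
  by rewrite divr_ge0 ?ler_pdivrMr 1?mulrC ?sl//; lra.
have nl1 : (size (P j))%:R * l <= 1.
  rewrite leNgt; apply/negP => nl1; apply: (noU k.+1 a.1).
  by move=> y /edge_dir_chart[s s01 ->]; apply: aU => //; lra.
exists k.+1, a.2; split=> //; first by rewrite mulr_gt0.
move=> _ [s + <-]; rewrite /= in_itv /= => /andP[s0 sl].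
by have := aU s; rewrite (surjective_pairing a) /=; apply=> //; lra.
Qed.

(* An arc whose image contains a vertex in its interior creates a germ. *)
Lemma arc_step U j l : traverses L j (P j) ->
  (forall i l', 0 < l' -> ~ germ_in U i l') -> arc_in U j l ->
  exists2 i, successor (P j) i & arc_in U i ((size (P j))%:R * l).
Proof.
move=> tP nogerm [k [b [c [b0 bc c1 <- bcU]]]]; have [p0 Lp] := tP.
have n0 : 0 < (size (P j))%:R :> R by rewrite ltr0n.
(* Here [q] is the index of the subinterval containing [b], and [s] the position of the image of [b]
   on the edge [(i, d)]. *)
have b01 : 0 <= b < 1 by lra.
have [q [[i d] [s [pq s01 bE]]]] := edge_position p0 b01.
exists i; first exact: onth_successor pq.
set n : R := (size (P j))%:R in n0 bE *.
have aU t : s <= t <= 1 -> t <= n * c - q%:R ->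
    (iter k.+1 L @` U) (dir_chart (i, d) t).
  move=> st tc; have t01 : 0 <= t <= 1 by lra.
  rewrite -(Lp _ _ _ pq t01); apply: (image_iterS bcU).
  exists (chart j ((q%:R + t) / n)) => //.
  exists ((q%:R + t) / n) => //; rewrite /= in_itv /= bE.
  by rewrite ler_pM2r ?invr_gt0// ler_pdivrMr// mulrC; lra.
have nb : n * b = q%:R + s by rewrite bE mulrC divfK// gt_eqF.
have nc : n * b < n * c by rewrite ltr_pM2l.
(* If [c] lies beyond the [q]-th subinterval, the image passes the end vertex of [(i, d)]; read
   backwards from there, it contains a germ of length [1 - s]. *)
have [qc|qc] := ltrP (q%:R + 1) (n * c).
  case: (nogerm i (1 - s)); first lra.
  exists k.+1, (~~ d); split; [lra|lra|] => _ [t + <-].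
  by rewrite /= in_itv /= dir_chartN => ts; apply: aU; lra.
(* The image stays in one edge; when [d] is [true], chart parameters are reversed. *)
exists k.+1; case: d pq aU => pq aU.
  exists (1 - (n * c - q%:R)), (1 - s); split; [lra|lra|lra|lra|] => _ [t + <-].
  rewrite /= in_itv /= => tsc; have := aU (1 - t).
  by rewrite /dir_chart /= subKr; apply; lra.
exists s, (n * c - q%:R); split; [lra|lra|lra|lra|] => _ [t + <-].
by rewrite /= in_itv /= => tsc; apply: aU; lra.
Qed.

(** If no edge is ever covered, [unbounded_length] excludes first germs, then arcs, whereas [U]
    itself contains an arc. *)
Lemma iter_covers_edge U : (0 < edge_num G)%N ->
  (forall j, traverses L j (P j)) -> irreducible_mx (markov_matrix L) ->
  (exists j, (1 < size (P j))%N) -> open U -> U !=set0 ->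
  exists k i, edge i `<=` iter k L @` U.
Proof.
move=> e0 PP Mirr P2 oU U0; apply: contrapT => noU.
have {}noU k i : ~ edge i `<=` iter k L @` U by move=> ?; apply: noU; exists k, i.
have suc1 j i i' : size (P j) = 1%N -> successor (P j) i ->
    successor (P j) i' -> i = i'.
  rewrite /successor /=; case: (P j) => [|a []]//= _.
  by rewrite !inE => /eqP-> /eqP->.
have unb := unbounded_length Mirr (fun j => (PP j).1) P2
  (fun i j => @markov_successor _ _ _ i j _ (PP j)) suc1.
have nogerm i l : 0 < l -> ~ germ_in U i l.
  by apply: unb => j l' => [[?[?[]]]//|]; exact: germ_step.
have noarc i l : 0 < l -> ~ arc_in U i l.
  apply: unb => j l' => [[?[?[?[]]]]|]; first by lra.
  exact: arc_step.
have [j [b [c [b0 bc c1 bcU]]]] := open_arc e0 oU U0.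
apply: (noarc j (c - b)); first by lra.
exists 0%N, b, c; split=> // x /bcU Ux; by exists x.
Qed.

End Expansion.

(** * From the linearization to transitivity *)

Lemma linearization_traverses (R : realType) (G : graph R) (f L : G -> G) j :
  vertex_map f -> is_linearization f L -> exists p, traverses L j p.
Proof.
move=> [_ [_ finj _]] [_ /(_ j)[p [pathp _ [_ speed] _]]].
exists p; split; last by move=> k a s pk; exact: speed pk s.
case: p pathp {speed} => //= fE; have [v0 v1] := chart_boundary j.
(* An empty path would make [f] identify the two end vertices of edge [j], against injectivity on
   vertices. *)
have : (0 : R) = 1; last by lra.
apply: (@chart_inj _ _ j); rewrite ?lexx ?ler01//.
by apply: finj fE; rewrite inE.
Qed.

(** On each edge, [L] is the final slice of the continuous homotopy [H]. *)
Lemma linearization_continuous (R : realType) (G : graph R) (f L : G -> G) :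
  (0 < edge_num G)%N -> is_linearization f L -> continuous L.
Proof.
move=> e0 [_ linL]; apply: graph_continuous => // i.
have [p [_ _ _ [H [cH _ H1 _]]]] := linL i.
apply: (@eq_within_continuous _ _ (H \o (fun t => (1, t)))) => [t|].
  by rewrite /= in_itv /=; exact: H1.
apply: within_continuous_comp cH _.
  apply: continuous_subspaceT => t.
  exact: (cvg_pair (cvg_cst (1 : R)) (@cvg_id _ (nbhs t))).
by move=> t /= t01; split=> //=; rewrite in_itv /= ler01 lexx.
Qed.

Theorem theorem6 (R : realType) (G : graph R) (f L : G -> G) :
  vertex_map f -> is_linearization f L ->
  irreducible_mx (markov_matrix L) -> ~~ is_perm_mx (markov_matrix L) ->
  topologically_transitive L.
Proof.
move=> vf lf Mirr Mperm.
have e0 : (0 < edge_num G)%N.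
  (* With no edge, the empty matrix is a permutation matrix. *)
  rewrite lt0n; apply: contraNneq Mperm => e0.
  apply/existsP; exists 1%g; apply/eqP/matrixP => i.
  by have := ltn_ord i; rewrite [X in (_ < X)%N]e0.
have cL := linearization_continuous e0 lf.
have /choice[P PP] : forall j, exists p, traverses L j p.
  by move=> j; exact: linearization_traverses vf lf.
have P2 : exists j, (1 < size (P j))%N.
  apply: contrapT => nP2; move/negP: Mperm; apply.
  apply: markov_is_perm cL PP Mirr _ => j.
  by rewrite leqNgt; apply/negP => Pj; apply: nP2; exists j.
split=> //; first exact: graph_compact.
move=> U V oU _ U0 [y Vy].
have [k [i iU]] := iter_covers_edge e0 PP Mirr P2 oU U0.
have /seteqP[/(_ y I)[i' _ i'y] _] := edge_cover e0.
(* Irreducibility gives [m > 0], so the total time [m + k] is positive even if [k] is 0. *)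
have [m m0 /edge_iter_cover /(_ y i'y)[x /iU[u Uu ux] xy]] := Mirr i' i.
exists (m + k)%N; first by rewrite addn_gt0 m0.
by exists y; split=> //; exists u => //; rewrite iterD ux.
Qed.
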